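(* Let $m\ge2$, let $q_1,\dots,q_m$ be nonzero integers, and let $n$ be a prime. Let $A$ be the $m\times m$ integer matrix whose first row is $(1,1,\dots,1)$ and whose $i$-th row, for $2\le i\le m$, has entry $-q_1$ in column $1$, entry $q_i$ in column $i$, and $0$ in all other columns. If all of the $q_i$ are coprime to $n$, then the mod $n$ nullity of $A$ is $1$ if $n$ divides $$\det A=q_1q_2\cdots q_m\left(\frac1{q_1}+\frac1{q_2}+\cdots+\frac1{q_m}\right),$$ and is $0$ otherwise.
   Context: The mod $n$ nullity of an integer matrix, for $n$ prime, is the dimension over $\mathbb{Z}/n\mathbb{Z}$ of the null space of its reduction modulo $n$. The matrix $A$ is the coefficient matrix of the linear system $d_1+\cdots+d_m=0$, $-q_1d_1+q_id_i=0$ ($2\le i\le m$), associated to the pretzel knot $P(q_1,\dots,q_m)$ with $m$ twist regions, the $i$-th of which has $q_i$ half-twists ($q_i$ may be positive or negative). *)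

(* Defs.v *)
From mathcomp Require Import all_boot all_order all_algebra.

Set Implicit Arguments.
Unset Strict Implicit.
Unset Printing Implicit Defensive.

Import GRing.Theory Num.Theory.
Local Open Scope ring_scope.

(* The first row/column is the one whose index has value 0; in the column with
   j = 0, the entry - q j is therefore - q_1. *)
Definition pretzel_mx (m : nat) (q : 'I_m -> int) : 'M[int]_m :=
  \matrix_(i < m, j < m)
    if i == 0 :> nat then 1
    else if j == 0 :> nat then - q j
    else if j == i then q i
    else 0.

(* 'F_n is Z/nZ only when n is prime. The null space is that of column vectors
   x such that A x = 0 (kermx would be the left kernel). *)
Definition mod_nullity (n r c : nat) (A : 'M[int]_(r, c)) : nat :=
  let B : 'M['F_n]_(r, c) := map_mx intr A in
  \dim (lker (linfun (mulmx B : 'cV['F_n]_c -> 'cV['F_n]_r))).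

(* Main.v *)
Require Import Defs.
From mathcomp Require Import all_boot all_order all_algebra.

Import GRing.Theory Num.Theory.
Local Open Scope ring_scope.

(** Over any field in which every [q i] is invertible, the last equations
    [q i * d i = q 0 * d 0] force a solution to be a multiple of
    [v = (1 / q i)_i], and the matrix sends [v] to the vector with entry
    [s = \sum_i 1 / q i] in the row of index 0 and zeros elsewhere.  Hence the null space
    is the line through [v] if [s = 0], and is trivial otherwise
    ([dim_lker_pretzel]).  Replacing the column of index 0 by the image of
    [q 0 *: v], which is a unimodular column operation, makes the matrix upper
    triangular with diagonal [q 0 * s, q 1, q 2, ...]; this gives the
    determinant ([det_pretzel_over]).  The theorem uses the determinant formula
    over the rationals, and both facts over the field with [n] elements, where
    the determinant vanishes exactly when [s] does. *)

(** The coefficient matrix of the pretzel system with coefficients in a ring;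
    the size is a successor, so that the index 0 exists. *)
Definition pretzel_over {R : pzRingType} {m : nat} (q : 'I_m.+1 -> R) :
    'M[R]_m.+1 :=
  \matrix_(i, j)
    if i == 0 then 1 else if j == 0 then - q j else if j == i then q i else 0.

Lemma map_pretzel_mx (R : pzRingType) (m : nat) (q : 'I_m.+1 -> int) :
  map_mx intr (pretzel_mx q) = pretzel_over (fun i => (q i)%:~R : R).
Proof.
apply/matrixP => i j; rewrite !mxE -!val_eqE /=.
by do 3?[case: ifP => _ //]; rewrite rmorphN.
Qed.

Lemma pretzel_over_mul0 (R : pzRingType) (m p : nat) (q : 'I_m.+1 -> R)
    (x : 'M[R]_(m.+1, p)) k :
  (pretzel_over q *m x) 0 k = \sum_j x j k.
Proof. by rewrite mxE; apply: eq_bigr => j _; rewrite mxE eqxx mul1r. Qed.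

Lemma pretzel_over_mulS (R : pzRingType) (m p : nat) (q : 'I_m.+1 -> R)
    (x : 'M[R]_(m.+1, p)) i k :
  i != 0 -> (pretzel_over q *m x) i k = q i * x i k - q 0 * x 0 k.
Proof.
move=> i0; rewrite mxE (bigD1 i) //= (bigD1 0) 1?eq_sym //=.
rewrite !mxE (negPf i0) !eqxx mulNr big1 ?addr0 // => j /andP[ji j0].
by rewrite mxE (negPf i0) (negPf j0) (negPf ji) mul0r.
Qed.

Lemma det_pretzel_over (F : fieldType) (m : nat) (q : 'I_m.+1 -> F) :
  (forall i, q i != 0) ->
  \det (pretzel_over q) = (\prod_i q i) * \sum_i (q i)^-1.
Proof.
move=> q0.
(* Right multiplication by [L] replaces column 0 by the sum of the columns [j]
   weighted by [q 0 / q j]; the weight of column 0 itself is 1. *)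
pose L : 'M[F]_m.+1 := \matrix_(i, j) if j == 0 then q 0 / q i else (i == j)%:R.
have detL : \det L = 1.
  rewrite det_trig.
    by apply: big1 => i _; rewrite mxE eqxx; case: eqP => // ->; rewrite divff.
  apply/is_trig_mxP => i j ij; rewrite mxE -!val_eqE /= (ltn_eqF ij).
  by rewrite gtn_eqF // (leq_ltn_trans _ ij).
have US (i j : 'I_m.+1) : i != 0 -> (pretzel_over q *m L) i j = q i * (i == j)%:R.
  move=> i0; rewrite pretzel_over_mulS // !mxE; case: eqVneq => [->|j0].
    by rewrite (negPf i0) mulr0 divff // mulr1 mulrCA divff // mulr1 subrr.
  by rewrite mulr0 subr0.
have U00 : (pretzel_over q *m L) 0 0 = q 0 * \sum_i (q i)^-1.
  rewrite pretzel_over_mul0 mulr_sumr.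
  by apply: eq_bigr => i _; rewrite mxE eqxx.
rewrite -[LHS]mulr1 -[X in _ * X = _]detL -det_mulmx -det_tr det_trig; last first.
  apply/is_trig_mxP => i j ij; rewrite mxE US.
    by rewrite -val_eqE /= gtn_eqF ?mulr0.
  by rewrite -val_eqE /= gtn_eqF // (leq_ltn_trans _ ij).
rewrite (bigD1 0) //= [X in _ = X * _](bigD1 0) //= mxE U00 mulrAC.
by congr (_ * _ * _); apply: eq_bigr => i i0; rewrite mxE US // eqxx mulr1.
Qed.

Lemma dim_lker_pretzel (F : fieldType) (m : nat) (q : 'I_m.+1 -> F) :
  (forall i, q i != 0) ->
  \dim (lker (linfun (mulmx (pretzel_over q) : 'cV[F]_m.+1 -> 'cV[F]_m.+1)))
    = (\sum_i (q i)^-1 == 0).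
Proof.
move=> q0; set s := \sum_i _; set K := lker _.
pose v : 'cV[F]_m.+1 := \col_i (q i)^-1.
have v0 : v != 0.
  by apply/eqP => /matrixP/(_ 0 0)/eqP; rewrite !mxE invr_eq0 (negPf (q0 0)).
have KE x : (x \in K) = (pretzel_over q *m x == 0).
  by rewrite memv_ker lfunE.
have Kv x : x \in K -> x = (q 0 * x 0 0) *: v.
  rewrite KE => /eqP xK; apply/matrixP => i j; rewrite ord1 !mxE.
  have [->|i0] := eqVneq i 0; first by rewrite mulrAC divff // mul1r.
  have /eqP := congr1 (fun y : 'cV[F]_m.+1 => y i 0) xK.
  rewrite pretzel_over_mulS // mxE subr_eq0 => /eqP <-.
  by rewrite mulrAC divff // mul1r.
have mulv i : (pretzel_over q *m v) i 0 = if i == 0 then s else 0.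
  case: (eqVneq i 0) => [->|i0].
    by rewrite pretzel_over_mul0; apply: eq_bigr => j _; rewrite mxE.
  by rewrite pretzel_over_mulS // !mxE !divff // subrr.
case: (eqVneq s 0) => [s0|s0] /=.
  suff -> : K = <[v]>%VS by rewrite dim_vline v0.
  apply/eqP; rewrite eqEsubv -memvE; apply/andP; split.
    by apply/subvP => x /Kv ->; apply: memvZ (memv_line _).
  rewrite KE; apply/eqP/matrixP => i j.
  by rewrite ord1 mulv s0 if_same mxE.
apply/eqP; rewrite dimv_eq0 -subv0; apply/subvP => x xK.
move: (xK); rewrite KE {1}(Kv x xK) -scalemxAr => /eqP/matrixP/(_ 0 0)/eqP.
rewrite mxE mulv eqxx mxE mulf_eq0 (negPf s0) orbF => /eqP c0.
by rewrite (Kv x xK) c0 scale0r mem0v.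
Qed.

Theorem claim19 (m : nat) (q : 'I_m -> int) (n : nat)
    (hm : (2 <= m)%N) (hq : forall i : 'I_m, q i != 0) (hn : prime n) :
  (\det (pretzel_mx q))%:~R
    = (\prod_(i < m) (q i)%:~R) * (\sum_(i < m) ((q i)%:~R)^-1) :> rat
  /\ ((forall i : 'I_m, coprimez (q i) n%:Z) ->
      mod_nullity n (pretzel_mx q)
        = if (n%:Z %| \det (pretzel_mx q))%Z then 1%N else 0%N).
Proof.
case: m q hm hq => // m q _ hq; split=> [|hc].
  by rewrite -det_map_mx map_pretzel_mx det_pretzel_over // => i; rewrite intr_eq0.
have qn0 i : (q i)%:~R != 0 :> 'F_n.
  rewrite -(dvdz_pcharf (pchar_Fp hn)) dvdzE absz_nat -prime_coprime // coprime_sym.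
  exact: hc.
rewrite /mod_nullity map_pretzel_mx dim_lker_pretzel // (dvdz_pcharf (pchar_Fp hn)).
rewrite -det_map_mx map_pretzel_mx det_pretzel_over // mulf_eq0.
have /negPf -> : \prod_i (q i)%:~R != 0 :> 'F_n by apply/prodf_neq0.
by case: (_ == _).
Qed.
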